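(* Let $n\ge 1$ be an integer and let $F(n)$ be the random variable whose value is the number of faces in a random embedding of the complete graph $K_n$. Then $\mathbb{E}[F(n)]\le 10\ln n+2$. Moreover, if $n\ge e^{e^{16}}$, then $\mathbb{E}[F(n)]\le 3.65\ln n$.
   Context: A rotation system of a graph $G$ is a choice, for each vertex $v$, of a cyclic permutation $R_v$ (a single cycle) of the darts at $v$, where a dart is a pair $(v,e)$ with $e$ an edge incident with $v$. Let $R$ be the product of all $R_v$, and let $L$ be the fixed-point-free involution on the set of all darts that swaps the two darts $(u,e),(v,e)$ of each edge $e=uv$. Rotation systems correspond to (equivalence classes of) 2-cell embeddings of a connected graph $G$ in oriented closed surfaces; the faces of the embedding are the cycles of $R\circ L$ (the one-vertex graph without edges has one face). A random embedding of $G$ is one given by a rotation system chosen uniformly at random among all $\prod_{v}(\deg(v)-1)!$ rotation systems. *)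

(* Defs.v *)
From HB Require Import structures.
From mathcomp Require Import all_boot all_order all_algebra all_fingroup.
From mathcomp Require Import all_classical all_reals all_analysis.

Set Implicit Arguments.
Unset Strict Implicit.
Unset Printing Implicit Defensive.

Import Order.TTheory GRing.Theory Num.Theory.

Record sgraph := SGraph {
  vertex :> finType;
  adj : rel vertex;
  adj_sym : symmetric adj;
  adj_irr : irreflexive adj
}.

Definition complete_graph (n : nat) : sgraph :=
  @SGraph 'I_n (fun i j => i != j)
    (fun i j => congr1 negb (eq_sym i j))
    (fun i => congr1 negb (eqxx i)).

Section RotationSystems.

Variable G : sgraph.

(* The dart (v, e), where e = vw, is encoded as the ordered pair (v, w): since
   G is simple, e is determined by its two ends. *)
Definition dart : finType := {d : G * G | adj d.1 d.2}.

Definition darts_at (v : G) : {set dart} := [set d | (val d).1 == v].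

Lemma swap_subproof (d : dart) : adj (val d).2 (val d).1.
Proof. by rewrite adj_sym; exact: (valP d). Qed.

Definition swap_dart (d : dart) : dart :=
  exist (fun d : G * G => adj d.1 d.2) ((val d).2, (val d).1) (swap_subproof d).

Lemma swap_dartK : involutive swap_dart.
Proof. by case=> [[u v] uv]; apply: val_inj. Qed.

Definition dart_swap : {perm dart} := perm (inv_inj swap_dartK).

(* A permutation of A is represented as a permutation of all the darts that
   fixes every dart outside A. The empty permutation of the empty set counts as
   a single cycle, so that an isolated vertex has exactly one rotation. *)
Definition single_cycle_on (A : {set dart}) (s : {perm dart}) : bool :=
  perm_on A s && [forall d in A, porbit s d == A].

Definition rotation_system : finType :=
  {r : {ffun G -> {perm dart}} |
    [forall v, single_cycle_on (darts_at v) (r v)]}.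

(* The factors have disjoint supports, so their order is irrelevant. *)
Definition rotation_product (r : rotation_system) : {perm dart} :=
  (\prod_(v : G) val r v)%g.

(* Permutations multiply from left to right: L * R is the composite R \o L.
   A one-vertex graph has no dart but it has one face. *)
Definition num_faces (r : rotation_system) : nat :=
  if #|G| == 1 then 1 else #|porbits (dart_swap * rotation_product r)%g|.

End RotationSystems.

Local Open Scope ring_scope.

Definition uniform_expectation (R : realType) (T : finType) (X : T -> R) : R :=
  \sum_(t : T) #|T|%:R^-1 * X t.

Definition expected_num_faces (R : realType) (G : sgraph) : R :=
  uniform_expectation (fun r : rotation_system G => (num_faces r)%:R).

(* Main.v *)
Require Import Defs.
From mathcomp Require Import all_boot all_order all_algebra all_fingroup.
From mathcomp Require Import all_classical all_reals all_analysis.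
From mathcomp Require Import zify ring lra.

(* Order the vertices v_1 < ... < v_n and count each face at its largest vertex
   v. Follow a face from a dart at v to a smaller vertex and reveal the
   rotations along the way. Whenever the walk reaches one of the j vertices that
   are not smaller than v, exchanging two blocks of the rotation at the last
   vertex shows that v is hit with probability at most 1/j; hence the walk comes
   back r times to v, without having met a larger vertex, with probability at
   most j^-r. The same exchange at v shows that it then closes up with
   probability at most 1/(n-2r). Weighting by 1/r each of the r darts of the face
   at v and summing over the darts gives at most c * sum_j sum_r j^-r/r + O(1),
   which is 2 c ln n + O(1); cutting the sum off at r ~ 2n/9 allows c = 9/5. *)

Set Implicit Arguments.
Unset Strict Implicit.
Unset Printing Implicit Defensive.

Import Order.TTheory GRing.Theory Num.Theory.

(** * Exchanging two blocks of a cycle *)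

Section BlockSwitch.

Variable T : finType.
Implicit Types (s : {perm T}) (K : {set T}).

(** The first iterate of [a] outside [K], if there is one. With [K] the darts whose successor is
    revealed, it ends the revealed block that starts at [a]. *)
Definition block_end K s (a : T) : T :=
  iter (find (fun k => iter k s a \notin K) (iota 0 #|T|)) s a.

Lemma block_endP K s a u : u \in porbit s a -> u \notin K ->
  exists2 k, block_end K s a = iter k s a /\ iter k s a \notin K &
             forall m, m < k -> iter m s a \in K.
Proof.
rewrite porbit_traject => /trajectP[m lem ->] uK.
set p := fun k => iter k s a \notin K.
have lt_mT : m < #|T| := leq_trans lem (max_card _).
have hp : has p (iota 0 #|T|) by apply/hasP; exists m; rewrite ?mem_iota.
have lt_f : find p (iota 0 #|T|) < #|T| by move: hp; rewrite has_find size_iota.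
exists (find p (iota 0 #|T|)).
  by split=> //; have := nth_find 0 hp; rewrite nth_iota.
move=> j lt_j; have := before_find 0 lt_j; rewrite nth_iota ?add0n.
  by move=> /negbFE.
exact: ltn_trans lt_j lt_f.
Qed.

Lemma eq_block_end K s s' a u :
    u \in porbit s a -> u \notin K -> {in K, s =1 s'} ->
  block_end K s' a = block_end K s a.
Proof.
move=> ua uK eq_s; have [k [-> ekK] ltK] := block_endP ua uK.
have iter_eq m : m <= k -> iter m s' a = iter m s a.
  elim: m => //= m IH ltm; rewrite IH ?(ltnW ltm) // eq_s ?ltK //.
have ek' : iter k s' a \notin K by rewrite iter_eq.
have ka' : iter k s' a \in porbit s' a by rewrite -permX mem_porbit.
have [k' [-> ek'K] ltK'] := block_endP ka' ek'.
have [lt|lt|kk] := ltngtP k k'; last by rewrite -kk iter_eq.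
- by have := ltK' _ lt; rewrite (negbTE ek').
- by have := ltK _ lt; rewrite -iter_eq ?(ltnW lt) // (negbTE ek'K).
Qed.

(** If [s] has the cycle [u, a..e, X, b, Y] with [e] the block end, the result has the cycle
    [u, b, X, a..e, Y]. *)
Definition switch K a b s : {perm T} :=
  (tperm b (block_end K s a) * s * tperm a b)%g.

Lemma switch_inj K a b s1 s2 : block_end K s1 a = block_end K s2 a ->
  switch K a b s1 = switch K a b s2 -> s1 = s2.
Proof. by rewrite /switch => -> /mulIg /mulgI. Qed.

Variables (K : {set T}) (s : {perm T}) (a b u : T).
Hypotheses (su : s u = a) (uK : u \notin K).
Hypotheses (ab : a != b) (b_a : b \in porbit s a).
Hypotheses (bK : b \notin K) (bu : b != u) (bsK : forall c, c \in K -> s c != b).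

Let e := block_end K s a.

Let u_a : u \in porbit s a.
Proof. by rewrite porbit_sym -su -(expg1 s) mem_porbit. Qed.

Let e_neq_b : e != b.
Proof.
rewrite /e; have [[|k] [-> _] ltK] := block_endP u_a uK; first by [].
exact/bsK/ltK.
Qed.

Let eK : e \notin K.
Proof. by rewrite /e; have [k [-> ekK] _] := block_endP u_a uK. Qed.

Let e_a : e \in porbit s a.
Proof. by rewrite /e; have [k [-> _] _] := block_endP u_a uK; rewrite -permX mem_porbit. Qed.

(* Otherwise the cycle of a would be closed up inside K, thus missing b. *)
Let e_neq_u : e != u.
Proof.
rewrite /e; have [k [-> ekK] ltK] := block_endP u_a uK.
apply/negP=> /eqP eku.
have sub m : exists2 i, i <= k & iter m s a = iter i s a.
  elim: m => [|m [i le_ik /= ->]]; first by exists 0.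
  have [lt_ik|] := ltnP i k; first by exists i.+1.
  move=> le_ki; have -> : i = k by apply/anti_leq/andP.
  by exists 0 => //; rewrite eku.
have [m] := porbitP _ _ _ b_a; rewrite permX.
have [[|i] lei ->] := sub m => bE; first by move: ab; rewrite bE eqxx.
by have := bsK (ltK _ lei); rewrite bE eqxx.
Qed.

(** Only [u] is sent to [a], nothing in [K] is sent to [b], and [b] and [e] lie outside [K]: neither
    transposition acts on the revealed part. *)
Lemma switchE : {in K, switch K a b s =1 s}.
Proof.
move=> c cK; rewrite /switch !permM -/e.
have cu : c != u by apply: contraNneq uK => <-.
rewrite (@tpermD _ b e); first last.
- by apply: contraNneq eK => ->.
- by apply: contraNneq bK => ->.
by rewrite tpermD // -1?su ?(inj_eq perm_inj) 1?eq_sym ?cu ?bsK // eq_sym.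
Qed.

Lemma switch_at : switch K a b s u = b.
Proof. by rewrite /switch !permM -/e (@tpermD _ b e) // su tpermL. Qed.

(** The block end depends only on values on [K], which the switch keeps; hence the switch can be
    undone. *)
Lemma block_end_switch : block_end K (switch K a b s) a = e.
Proof. by apply: eq_block_end u_a uK _ => c cK; rewrite switchE. Qed.

(* The first transposition splits the cycle into one through b and one through
   the block of a, and the second one merges these again. *)
Lemma card_porbits_switch : #|porbits (switch K a b s)| = #|porbits s|.
Proof.
pose s1 := (tperm b e * s)%g.
have bs_e : b \in porbit s e.
  by move: b_a e_a; rewrite -!eq_porbit_mem => /eqP -> /eqP ->.
have c1 : #|porbits s1| = #|porbits s|.+1.
  have /= := porbits_mul_tperm s b e.
  by rewrite bs_e addn0 eq_sym e_neq_b addn1.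
have b_e : b \notin porbit s1 e.
  have /= := porbits_mul_tperm s1 b e.
  rewrite /s1 mulgA tperm2 mul1g -/s1 c1 eq_sym e_neq_b.
  case: (b \in _) => //=; rewrite !addn0 addn1 => /esym/eqP.
  by rewrite -addn2 -{2}(addn0 #|_|) eqn_add2l.
have e_s1a : e \in porbit s1 a.
  have [k [ek ekK] ltK] := block_endP u_a uK.
  have iter_eq m : m <= k -> iter m s1 a = iter m s a.
    elim: m => //= m IH ltm; rewrite IH ?(ltnW ltm) // /s1 permM tpermD //.
      by apply: contraNneq bK => ->; exact: ltK.
    by apply: contraNneq eK => ->; exact: ltK.
  by rewrite /e ek -iter_eq // -permX mem_porbit.
have a_b : a \notin porbit s1 b.
  move: e_s1a b_e; rewrite -eq_porbit_mem => /eqP ->.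
  by rewrite porbit_sym.
rewrite -porbitsV /switch -/e -/s1 invMg tpermV.
have /= := porbits_mul_tperm s1^-1%g a b.
by rewrite porbitV a_b porbitsV c1 ab addn2 addn1 => -[].
Qed.

End BlockSwitch.

(** * Permutations with prescribed orbits, and exchanges along a walk *)

Section Rotations.

Variables (T V : finType) (h : T -> V).
Implicit Type s : {perm T}.

(** With [h] the tail of a dart, these are the products of all rotations of a rotation system. *)
Definition rotations : {set {perm T}} :=
  [set s | [forall d, porbit s d == [set d' | h d' == h d]]].

Lemma rotationsP s :
  reflect (forall d d', (d' \in porbit s d) = (h d' == h d)) (s \in rotations).
Proof.
rewrite inE; apply: (iffP forallP) => [rs d d' | rs d].
  by rewrite (eqP (rs d)) inE.
by apply/eqP/setP=> d'; rewrite rs inE.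
Qed.

Lemma rotations_h s d : s \in rotations -> h (s d) = h d.
Proof. by move/rotationsP=> rs; apply/eqP; rewrite -rs -{1}(expg1 s) mem_porbit. Qed.

Lemma h_porbit s d d' : (forall x, h (s x) = h x) -> d' \in porbit s d -> h d' = h d.
Proof.
move=> hs /porbitP[i ->]; rewrite permX.
by elim: i => //= i IH; rewrite hs.
Qed.

(** The orbits of [s'] refine the fibres of [h] and are equally many, so each nonempty fibre is one
    orbit. *)
Lemma rotations_card s s' : s \in rotations -> (forall d, h (s' d) = h d) ->
  #|porbits s'| = #|porbits s| -> s' \in rotations.
Proof.
move=> /rotationsP rs hs' eq_card.
pose cl d := [set d' | h d' == h d].
have cls : porbits s = cl @: T.
  by apply: eq_imset => d; apply/setP=> d'; rewrite rs inE.
pose c (O : {set T}) := \bigcup_(d in O) cl d.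
have cE d : c (porbit s' d) = cl d.
  apply/setP=> x; apply/bigcupP/idP=> [[y /(h_porbit hs') yd]|xd].
    by rewrite !inE yd.
  by exists d; rewrite ?porbit_id.
have c_inj : {in porbits s' &, injective c}.
  apply/imset_injP; rewrite eq_card cls -imset_comp.
  by apply/eqP; congr #|pred_of_set _|; apply: eq_imset => d /=; rewrite cE.
apply/rotationsP=> d d'; apply/idP/eqP=> [/(h_porbit hs')//|hd].
rewrite -eq_porbit_mem; apply/eqP/c_inj; rewrite ?imset_f // !cE.
by apply/setP=> x; rewrite !inE hd.
Qed.

Variable L : {perm T}.

Definition walk (e0 : T) s t : T := iter t (L * s)%g e0.

Lemma walkS e0 s t : walk e0 s t.+1 = s (L (walk e0 s t)).
Proof. by rewrite /walk /= permM. Qed.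

(* The walk can only close up at its starting point. *)
Lemma walk_neq e0 s i t u : (forall k, 0 < k <= i -> walk e0 s k != e0) ->
  t < u -> u <= i -> walk e0 s t != walk e0 s u.
Proof.
move=> ne0; elim: t u => [|t IH] [|u] // ltu leu.
  by rewrite eq_sym; apply: ne0; rewrite leu.
rewrite !walkS (inj_eq perm_inj) (inj_eq perm_inj) IH //.
exact: ltnW.
Qed.

(* Conditioned on the first i steps of the walk, moving next to a is at most as
   likely as moving next to a dart b of the same vertex that is still untouched. *)
Lemma card_walk_switch (e0 a b : T) (i : nat) (P : pred {perm T}) :
    h a = h b -> a != b ->
    (forall s s', (forall t, t <= i -> walk e0 s t = walk e0 s' t) ->
       P s -> P s') ->
    (forall s, s \in rotations -> P s ->
       (forall k, 0 < k <= i -> walk e0 s k != e0) /\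
       (forall t, t <= i -> walk e0 s t != b /\ L (walk e0 s t) != b)) ->
  #|[set s in rotations | P s && (walk e0 s i.+1 == a)]| <=
  #|[set s in rotations | P s && (walk e0 s i.+1 == b)]|.
Proof.
move=> hab ab Pext Pdom.
(* The darts at which [s] has been read off by the first [i] steps. *)
pose K s := [set L (walk e0 s (val t)) | t : 'I_i].
have KE s t : t < i -> L (walk e0 s t) \in K s.
  by move=> lt_ti; apply/imsetP; exists (Ordinal lt_ti).
pose f s := switch (K s) a b s.
have main s : s \in rotations -> P s -> walk e0 s i.+1 = a ->
  [/\ f s \in rotations,
      forall t, t <= i -> walk e0 s t = walk e0 (f s) t,
      walk e0 (f s) i.+1 = b &
      block_end (K s) (f s) a = block_end (K s) s a].
  move=> rs Ps sa; have [ne0 nb] := Pdom s rs Ps.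
  pose u := L (walk e0 s i).
  have su : s u = a by rewrite -walkS.
  have uK : u \notin K s.
    apply/imsetP=> -[[t lt_ti] _ /= /perm_inj /eqP].
    by rewrite eq_sym (negbTE (walk_neq ne0 lt_ti _)).
  have b_a : b \in porbit s a by rewrite (rotationsP _ rs) hab.
  have bK : b \notin K s.
    apply/imsetP=> -[[t lt_ti] _ /= /eqP].
    by rewrite eq_sym (negbTE (nb t (ltnW lt_ti)).2).
  have bu : b != u by rewrite eq_sym (nb i (leqnn i)).2.
  have bsK c : c \in K s -> s c != b.
    by case/imsetP=> -[t lt_ti] _ /= ->; rewrite -walkS (nb _ lt_ti).1.
  have eqK := switchE su uK bK bsK.
  have eqw t : t <= i -> walk e0 s t = walk e0 (f s) t.
    elim: t => // t IH lt_ti; rewrite !walkS -IH ?(ltnW lt_ti) // eqK //.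
    exact: KE.
  split=> //; first 1 last.
  - by rewrite walkS -eqw // (switch_at su uK ab b_a bu bsK).
  - exact: (block_end_switch su uK bK bsK).
  apply: (rotations_card rs); last first.
    exact: (card_porbits_switch su uK ab b_a bK bsK).
  have u_a : u \in porbit s a.
    by rewrite porbit_sym -su -(expg1 s) mem_porbit.
  have [k [ek _] _] := block_endP u_a uK.
  (* The block end lies at the vertex of [b], so both transpositions preserve [h]. *)
  have he : h (block_end (K s) s a) = h b.
    rewrite ek -hab; elim: k {ek} => //= k <-; exact: rotations_h.
  have ht x y d : h x = h y -> h (tperm x y d) = h d by case: tpermP => // ->.
  by move=> d; rewrite /f /switch !permM ht // rotations_h // ht.
rewrite -(card_in_imset (f := f)).
  apply/subset_leq_card/fintype.subsetP=> _ /imsetP[s + ->].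
  rewrite 2!(finset.in_set (fun s0 => (s0 \in rotations) && _)) => /and3P[rs Ps /eqP sa].
  have [rfs eqw -> _] := main s rs Ps sa.
  by rewrite rfs eqxx (Pext _ _ eqw Ps).
(* Equal images give equal walks up to time [i], hence equal [K] and equal block ends, so the
   transpositions cancel. *)
move=> s1 s2; rewrite 2!(finset.in_set (fun s0 => (s0 \in rotations) && _)).
move=> /and3P[r1 P1 /eqP a1] /and3P[r2 P2 /eqP a2] eqf.
have [_ w1 _ e1] := main s1 r1 P1 a1.
have [_ w2 _ e2] := main s2 r2 P2 a2.
have eqK : K s1 = K s2.
  by apply: eq_imset => t /=; rewrite w1 ?(ltnW (ltn_ord t)) // eqf -w2 // ltnW.
by apply: (@switch_inj _ (K s1) a b); rewrite -?e1 eqK -?e2 -/(f s2) -eqf // /f -eqK.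
Qed.

End Rotations.

(** * Walks in the complete graph *)

Section FiniteCounting.

Variables (S W : finType) (A : {set S}).
Implicit Types P Q : pred S.

Lemma eq_set_in P Q : {in A, P =1 Q} -> [set s in A | P s] = [set s in A | Q s].
Proof. by move=> PQ; apply/setP=> s; rewrite !finset.in_set; apply: andb_id2l => /PQ. Qed.

Lemma set_in0 P : {in A, forall s, ~~ P s} -> [set s in A | P s] = finset.set0.
Proof.
move=> P0; apply/setP=> s; rewrite finset.in_set finset.in_set0.
by apply/negP=> /andP[/P0/negP].
Qed.

Lemma card_set_fiber P (f : S -> W) :
  #|[set s in A | P s]| = \sum_(w : W) #|[set s in A | P s && (f s == w)]|.
Proof.
rewrite -sum1_card (partition_big f predT) //=; apply: eq_bigr => w _.
by rewrite -sum1_card; apply: eq_bigl => s; rewrite !inE andbA.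
Qed.

Lemma card_set_sum P :
  #|[set s in A | P s]| = \sum_(s in A) P s.
Proof.
rewrite -sum1_card [RHS]big_mkcond /= big_mkcond /=; apply: eq_bigr => s _.
by rewrite inE; case: (s \in A).
Qed.

End FiniteCounting.

Lemma sum_nat_unique (M : nat) (P : pred nat) :
  (forall i j, P i -> P j -> i = j) -> \sum_(i < M) P i <= 1.
Proof.
move=> uniqP; case: (pickP (fun i : 'I_M => P i)) => [i Pi|P0].
  rewrite (bigD1 i) //= big1 ?addn0 ?leq_b1 // => j ji.
  by apply/eqP; rewrite eqb0; apply: contraNN ji => Pj; apply/eqP/val_inj/uniqP.
by rewrite big1 // => i _; rewrite P0.
Qed.

Section CompleteGraphWalks.

Variable n : nat.
Notation T := (dart (complete_graph n)).
Notation L := (dart_swap (complete_graph n)).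

Definition tail (d : T) : 'I_n := (val d).1.
Definition head (d : T) : 'I_n := (val d).2.

Lemma tail_swap d : tail (L d) = head d. Proof. by rewrite permE. Qed.
Lemma head_swap d : head (L d) = tail d. Proof. by rewrite permE. Qed.

Lemma dart_eqE (d d' : T) : (d == d') = (tail d == tail d') && (head d == head d').
Proof. by []. Qed.

Lemma tail_neq_head d : tail d != head d.
Proof. exact: (valP d). Qed.

Lemma exists_dart (w x : 'I_n) : w != x -> exists2 d : T, tail d = w & head d = x.
Proof. by move=> wx; exists (exist (fun d : 'I_n * 'I_n => d.1 != d.2) (w, x) wx). Qed.

Lemma card_tail (v : 'I_n) : #|[set d | tail d == v]| = n.-1.
Proof.
rewrite -(card_in_imset (f := head)); last first.
  move=> d d'; rewrite !inE => /eqP dv /eqP d'v hd.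
  by apply/eqP; rewrite dart_eqE dv d'v hd !eqxx.
transitivity #|[set~ v]|; last by rewrite cardsC1 card_ord.
congr #|pred_of_set _|; apply/setP=> x; rewrite !inE.
apply/imsetP/idP=> [[d + ->]|xv].
  by rewrite !inE => /eqP <-; rewrite eq_sym tail_neq_head.
have [|d dv dx] := @exists_dart v x; first by rewrite eq_sym.
by exists d; rewrite ?inE ?dv.
Qed.

Notation rots := (rotations tail).

Variable e0 : T.
Let v := tail e0.
Hypothesis head_e0 : head e0 < v.
Notation walk := (walk L e0).

Implicit Type s : {perm T}.

Lemma tail_walkS s t : s \in rots -> tail (walk s t.+1) = head (walk s t).
Proof. by move=> rs; rewrite walkS (rotations_h _ rs) tail_swap. Qed.

(** The head of the dart at time [t] is the vertex reached at time [t + 1]: up to time [i] the walk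
    has met no vertex above [v] and has not closed up. *)
Definition alive s i :=
  [forall t : 'I_i, (head (walk s t) <= v) && (walk s t.+1 != e0)].

Lemma aliveP s i : reflect
  (forall t, t < i -> head (walk s t) <= v /\ walk s t.+1 != e0) (alive s i).
Proof.
apply: (iffP forallP) => [al t lt_ti | al [t lt_ti]].
  by have /andP[] := al (Ordinal lt_ti).
by have [/= -> ->] := al t lt_ti.
Qed.

Definition returns s i : nat := \sum_(t < i) (head (walk s t) == v).

Lemma returnsS s i : returns s i.+1 = returns s i + (head (walk s i) == v).
Proof. by rewrite /returns big_ord_recr. Qed.

Lemma leq_returns s i j : i <= j -> returns s i <= returns s j.
Proof.
move=> /subnK <-; elim: (j - i) => // k IH.
by rewrite addSn returnsS (leq_trans IH) ?leq_addr.
Qed.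

(* Here r is the number of returns to v before time i, so that closes_at r is
   about the faces with r + 1 darts at v. *)
Definition hits (r i : nat) s := [&& alive s i, returns s i == r & v <= head (walk s i)].
Definition returns_at r i s := hits r i s && (head (walk s i) == v).
Definition exits_at r i s := hits r i s && (v < head (walk s i)).
Definition closes_at r i s := returns_at r i s && (walk s i.+1 == e0).

(** A walk still alive after time [i] did not go above [v] there, so the hit at [i] was a return and
    raised the counter. *)
Lemma hits_lt s r r' i i' : hits r i s -> hits r' i' s -> i < i' -> r < r'.
Proof.
case/and3P=> _ /eqP <- vi /and3P[/aliveP al /eqP <- _] lt_i.
have [le_v _] := al _ lt_i.
have hv : head (walk s i) == v by rewrite -val_eqE eqn_leq le_v.
by have := leq_returns s lt_i; rewrite returnsS hv addn1.
Qed.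

Lemma hits_uniq s r i i' : hits r i s -> hits r i' s -> i = i'.
Proof.
move=> h1 h2; have [lt|lt|//] := ltngtP i i'.
  by have := hits_lt h1 h2 lt; rewrite ltnn.
by have := hits_lt h2 h1 lt; rewrite ltnn.
Qed.

Lemma returns_at_pred s i r : alive s i -> r < returns s i ->
  exists2 j, j < i & returns_at r j s.
Proof.
elim: i r => [|i IH] r; first by rewrite /returns big_ord0.
move=> /aliveP al; rewrite returnsS => ltr.
have al' : alive s i by apply/aliveP=> t lt_ti; apply: al; exact: ltnW.
have [lt|le] := ltnP r (returns s i).
  by have [j lt_j ?] := IH r al' lt; exists j => //; exact: ltnW.
move: ltr; case hv: (head _ == v); last by rewrite addn0 ltnNge le.
rewrite addn1 ltnS => ler; exists i => //.
by rewrite /returns_at /hits hv al' (eqP hv) leqnn !andbT; apply/eqP/anti_leq/andP.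
Qed.

Lemma hits_returns_at s r r' i : hits r i s -> r' < r ->
  exists2 j, j < i & returns_at r' j s.
Proof. by case/and3P=> al /eqP <- _; exact: returns_at_pred. Qed.

Lemma eq_alive s s' i : (forall t, t <= i -> walk s t = walk s' t) ->
  alive s i = alive s' i.
Proof.
by move=> eqw; apply: eq_forallb => t; rewrite !eqw // ltnW.
Qed.

Lemma eq_returns s s' i : (forall t, t < i -> walk s t = walk s' t) ->
  returns s i = returns s' i.
Proof. by move=> eqw; apply: eq_bigr => t _; rewrite eqw. Qed.

Lemma tail_walk_le s i t : s \in rots -> alive s i -> t <= i -> tail (walk s t) <= v.
Proof.
by case: t => // t rs /aliveP al lt_ti; rewrite tail_walkS //; have [] := al t lt_ti.
Qed.

(** Fix the vertex [w] from which [v] is reached. The darts [a = wv] and [b = wx] share [w], and [b]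
    is untouched because a living walk has not met [x]; so they can be exchanged. *)
Lemma card_returns_le_exits_to r i (x : 'I_n) : v < x ->
  #|[set s in rots | returns_at r i s]| <=
  #|[set s in rots | exits_at r i s && (head (walk s i) == x)]|.
Proof.
move=> vx; case: i => [|i].
  rewrite set_in0 ?cards0 // => s _; apply/negP=> /andP[_].
  by rewrite -val_eqE; move: head_e0; rewrite /walk /=; lia.
rewrite (card_set_fiber _ _ (fun s => tail (walk s i.+1))).
rewrite [leqRHS](card_set_fiber _ _ (fun s => tail (walk s i.+1))).
apply: leq_sum => w _.
pose P s := [&& alive s i, head (walk s i) <= v & returns s i.+1 == r].
have [ltwv|levw] := ltnP w v; last first.
  rewrite set_in0 ?cards0 // => s rs.
  apply/negP=> /andP[/andP[/and3P[al _ _] /eqP hv] /eqP tw].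
  have le_wv : w <= v by rewrite -tw (tail_walk_le rs al).
  have /eqP wv : w == v by rewrite -val_eqE eqn_leq le_wv.
  by have := tail_neq_head (walk s i.+1); rewrite tw hv wv eqxx.
have [|a ta ha] := @exists_dart w v; first by rewrite -val_eqE neq_ltn ltwv.
have [|b tb hb] := @exists_dart w x.
  by rewrite -val_eqE neq_ltn (ltn_trans ltwv vx).
(* The heads of [a] and [b] differ from that of [e0], so arriving there does not close the walk:
   being alive is decided by the walk up to time [i]. *)
have aliveE s d : head d != head e0 -> walk s i.+1 = d -> alive s i.+1 =
    alive s i && (head (walk s i) <= v).
  move=> ad sd; apply/aliveP/andP => [al|[/aliveP al hi] t].
    by have [? _] := al i (ltnSn i); split=> //; apply/aliveP => t lt; apply/al/ltnW.
  rewrite ltnS leq_eqVlt => /predU1P[->|/al//]; split=> //.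
  by rewrite sd; apply: contraNneq ad => ->.
have hae : head a != head e0 by rewrite ha -val_eqE neq_ltn head_e0 orbT.
have hbe : head b != head e0.
  by rewrite hb -val_eqE neq_ltn (ltn_trans head_e0 vx) orbT.
have -> : [set s in rots | returns_at r i.+1 s && (tail (walk s i.+1) == w)] =
    [set s in rots | P s && (walk s i.+1 == a)].
  apply: eq_set_in => s rs.
  apply/andP/andP=> [[/andP[/and3P[al rr _] /eqP hv] /eqP tw]|[Ps /eqP sa]].
    have /eqP sa : walk s i.+1 == a by rewrite dart_eqE tw hv ta ha !eqxx.
    by rewrite sa /P andbA -(aliveE s a) // al.
  rewrite /returns_at /hits (aliveE s a) // sa ta ha !eqxx leqnn andbT.
  by case/and3P: Ps => -> -> ->.
have -> : [set s in rots | exits_at r i.+1 s && (head (walk s i.+1) == x)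
                           && (tail (walk s i.+1) == w)] =
    [set s in rots | P s && (walk s i.+1 == b)].
  apply: eq_set_in => s rs.
  apply/andP/andP=> [[/andP[/andP[/and3P[al rr _] _] /eqP hv] /eqP tw]|[Ps /eqP sa]].
    have /eqP sa : walk s i.+1 == b by rewrite dart_eqE tw hv tb hb !eqxx.
    by rewrite sa /P andbA -(aliveE s b) // al.
  rewrite /exits_at /hits (aliveE s b) // sa tb hb !eqxx vx (ltnW vx) !andbT.
  by case/and3P: Ps => -> -> ->.
apply: card_walk_switch.
- by rewrite ta tb.
- by rewrite dart_eqE ha hb negb_and -orbC -val_eqE neq_ltn vx.
- move=> s s' eqw; rewrite /P (eq_alive eqw) eqw //.
  by rewrite (@eq_returns s s' i.+1 eqw).
move=> s rs /and3P[al hi _]; split.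
  by case=> // k ltk; have [_] := aliveP _ _ al k ltk.
move=> t leti; split.
  suff : head (walk s t) <= v by apply: contraTneq => ->; rewrite hb -ltnNge.
  move: leti; rewrite leq_eqVlt => /predU1P[->//|lt]; by have [] := aliveP _ _ al t lt.
have := tail_walk_le rs al leti; apply: contraTneq => eb.
by rewrite -ltnNge -head_swap eb hb.
Qed.

End CompleteGraphWalks.

(** * Frequency of returns to the largest vertex and of closing up there *)

Section ReturnProbabilities.

Variable n : nat.
Notation T := (dart (complete_graph n)).
Notation L := (dart_swap (complete_graph n)).
Notation rots := (rotations (@tail n)).

Variable e0 : T.
Let v := tail e0.
Hypothesis head_e0 : head e0 < v.
Notation walk := (walk L e0).

Implicit Type s : {perm T}.

Lemma card_ord_gt (x : 'I_n) : #|[set y : 'I_n | x < y]| = n - x.+1.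
Proof.
rewrite -sum1_card (eq_bigl (fun y : 'I_n => x < y)); last by move=> y; rewrite inE.
rewrite -(big_mkord (fun y => x < y) (fun=> 1)).
rewrite (big_cat_nat (n := x.+1)) //= big1_seq ?add0n => [|y]; last first.
  by rewrite mem_index_iota; lia.
rewrite big_nat_cond (eq_bigl (fun y => (x.+1 <= y < n) && true)); last first.
  by move=> y; lia.
by rewrite -big_nat_cond sum_nat_const_nat muln1.
Qed.

(** Vertices are numbered from 0, so [n - v] of them are not smaller than [v]. Hits are returns or
    exits, and each of the [n - v - 1] larger vertices receives at least as many exits as there are
    returns. *)
Lemma card_hits r i :
  (n - v) * #|[set s in rots | returns_at e0 r i s]| <= #|[set s in rots | hits e0 r i s]|.
Proof.
have -> : #|[set s in rots | hits e0 r i s]| =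
    #|[set s in rots | returns_at e0 r i s]| + #|[set s in rots | exits_at e0 r i s]|.
  rewrite !card_set_sum -big_split /=; apply: eq_bigr => s _.
  rewrite /returns_at /exits_at -val_eqE /= /hits -/v.
  by case: (alive _ _ _); case: (_ == r) => //=; lia.
have lt_vn : v < n := ltn_ord v.
rewrite (_ : n - v = (n - v.+1).+1) ?mulSn ?leq_add2l; last by lia.
rewrite [leqRHS](card_set_fiber _ _ (fun s => head (walk s i))).
rewrite -card_ord_gt -sum_nat_const [leqRHS](bigID (mem [set y : 'I_n | v < y])) /=.
apply: leq_trans (leq_addr _ _); apply: leq_sum => x; rewrite inE => vx.
exact: card_returns_le_exits_to.
Qed.

(** A hit with counter [r + 1] occurs at most once and follows a return with counter [r]. *)
Lemma sum_hits r s M :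
  \sum_(i < M) hits e0 r.+1 i s <= \sum_(i < M) returns_at e0 r i s.
Proof.
case: (pickP (fun i : 'I_M => hits e0 r.+1 i s)) => [i hi|h0]; last first.
  by rewrite big1 // => i _; rewrite h0.
have uniq_hit : \sum_(k < M) hits e0 r.+1 k s <= 1.
  by apply: (@sum_nat_unique M (fun k => hits e0 r.+1 k s)) => j k; exact: hits_uniq.
apply: (leq_trans uniq_hit).
have [j lt_ji rj] := hits_returns_at hi (ltnSn r).
by rewrite (bigD1 (Ordinal (ltn_trans lt_ji (ltn_ord i)))) //= rj.
Qed.

(* Each time that the walk gets to a vertex not smaller than v, all these n - v
   vertices but v are equally likely, and v is at most as likely. *)
Lemma card_returns_at r M :
  (n - v) ^ r.+1 * \sum_(i < M) #|[set s in rots | returns_at e0 r i s]| <= #|rots|.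
Proof.
have step r' : (n - v) * \sum_(i < M) #|[set s in rots | returns_at e0 r' i s]| <=
    \sum_(s in rots) \sum_(i < M) hits e0 r' i s.
  rewrite exchange_big big_distrr /=; apply: leq_sum => i _.
  by rewrite -card_set_sum card_hits.
elim: r => [|r IH].
  rewrite expn1 (leq_trans (step 0)) // -sum1_card; apply: leq_sum => s _.
  by apply: (@sum_nat_unique M (fun k => hits e0 0 k s)) => i j; exact: hits_uniq.
apply: leq_trans IH; rewrite expnSr -mulnA leq_mul2l; apply/orP; right.
apply: leq_trans (step _) _.
under [leqRHS]eq_bigr => i _ do rewrite card_set_sum.
rewrite [leqRHS]exchange_big /=; apply: leq_sum => s _; exact: sum_hits.
Qed.

(** The walk has used [y] neither to leave [v] nor, reversed, to arrive there: such darts can be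
    exchanged with [e0]. *)
Definition fresh i s (y : T) :=
  (tail y == v) &&
  [forall t : 'I_i.+1, (walk s t != y) && (L (walk s t) != y)].

(** The walk left [v] at the start and after [r] returns, and arrived there [r + 1] times; this uses
    at most [2(r + 1)] of the [n - 1] darts at [v]. *)
Lemma card_fresh r i s : s \in rots -> returns_at e0 r i s ->
  n.-1 - 2 * r.+1 <= #|[set y | fresh i s y]|.
Proof.
move=> rs /andP[/and3P[al /eqP rr _] hv].
have retS : returns e0 s i.+1 = r.+1 by rewrite returnsS rr hv addn1.
pose W1 := [set walk s (val t) | t in [set t : 'I_i.+1 | tail (walk s t) == v]].
pose W2 := [set L (walk s (val t)) | t in [set t : 'I_i.+1 | head (walk s t) == v]].
have W2r : #|W2| <= r.+1.
  apply: leq_trans (leq_imset_card _ _) _; rewrite -retS /returns -sum1_card.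
  rewrite big_mkcond /=; apply: leq_sum => t _.
  by rewrite inE; case: eqP.
have W1r : #|W1| <= r.+1.
  apply: leq_trans (leq_imset_card _ _) _; rewrite -rr /returns -sum1_card.
  rewrite big_mkcond big_ord_recl /= inE /=.
  rewrite -[leqRHS]add1n; apply: leq_add; first by case: ifP.
  by apply: leq_sum => t _; rewrite inE tail_walkS //; case: eqP.
rewrite leq_subLR -(card_tail v).
have sub : [set d | tail d == v] \subset (W1 :|: W2) :|: [set y | fresh i s y].
  apply/fintype.subsetP=> y; rewrite finset.in_set => yv.
  rewrite !finset.in_setU finset.in_set /fresh yv /=.
  have [//|y1] := boolP (y \in W1); have [//|y2] := boolP (y \in W2).
  apply/forallP=> t; apply/andP; split.
    apply: contraNneq y1 => yt; apply/imsetP; exists t => //.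
    by rewrite inE yt.
  apply: contraNneq y2 => yt; apply/imsetP; exists t => //.
  by rewrite inE -tail_swap yt.
apply: leq_trans (subset_leq_card sub) _.
apply: leq_trans (leq_card_setU _ _) _; rewrite leq_add2r.
apply: leq_trans (leq_card_setU _ _) _; rewrite mul2n -addnn.
exact: leq_add.
Qed.

(** Double counting of closing permutations paired with fresh darts [y]: exchanging [e0] with [y]
    makes the walk continue to [y] instead. The successor in the factor accounts for [e0] itself. *)
Lemma card_closes_at r i :
  (n.-1 - 2 * r.+1).+1 * #|[set s in rots | closes_at e0 r i s]| <=
  #|[set s in rots | returns_at e0 r i s]|.
Proof.
pose CS := [set s in rots | closes_at e0 r i s].
rewrite -/CS [leqRHS](card_set_fiber _ _ (fun s => walk s i.+1)) (bigD1 e0) //= mulSn.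
apply: leq_add => //.
rewrite mulnC -sum_nat_const.
apply: leq_trans (_ : \sum_(s in CS) \sum_(y | y != e0) fresh i s y <= _).
  apply: leq_sum => s; rewrite finset.in_set => /and3P[rs ra we].
  apply: leq_trans (card_fresh rs ra) _.
  rewrite -sum1_card big_mkcond [leqRHS]big_mkcond /=; apply: leq_sum => y _.
  rewrite finset.in_set; case: (boolP (fresh i s y)) => // fy.
  case: eqP => // ye; move: fy; rewrite ye => /andP[_ /forallP/(_ ord0)/=].
  by rewrite /walk /= eqxx.
rewrite exchange_big; apply: leq_sum => y ye /=.
rewrite -(card_set_sum CS (fun s => fresh i s y)).
have [yv|yv] := boolP (tail y == v); last first.
  by rewrite set_in0 ?cards0 // => s _; rewrite /fresh (negbTE yv).
pose P s := returns_at e0 r i s && fresh i s y.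
have -> : [set s in CS | fresh i s y] = [set s in rots | P s && (walk s i.+1 == e0)].
  apply/setP=> s; rewrite finset.in_set !(finset.in_set (fun s => (s \in rots) && _)).
  by rewrite -andbA /P /closes_at; case: (returns_at _ _ _ _) => //=; congr andb; apply: andbC.
apply: leq_trans (_ : #|[set s in rots | P s && (walk s i.+1 == y)]| <= _); last first.
  apply: subset_leq_card; apply/fintype.subsetP=> s.
  rewrite !(finset.in_set (fun s => (s \in rots) && _)).
  by move=> /and3P[-> /andP[-> _] ->].
apply: card_walk_switch.
- by rewrite (eqP yv).
- by rewrite eq_sym.
- move=> s s' eqw /andP[/andP[/and3P[al rr hv] hv'] /andP[_ /forallP fr]].
  rewrite /P /returns_at /hits -(eq_alive eqw) al -(eq_returns (s := s)) ?rr; last first.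
    by move=> t lt; rewrite eqw // ltnW.
  rewrite -eqw // hv hv' /fresh yv; apply/forallP=> t.
  by rewrite -eqw ?fr // -ltnS.
move=> s rs /andP[/andP[/and3P[al _ _] _] /andP[_ /forallP fr]]; split.
  by case=> // k ltk; have [_] := aliveP _ _ _ al k ltk.
by move=> t leti; have /andP[] := fr (Ordinal (leti : t < i.+1)).
Qed.

End ReturnProbabilities.

(** * Counting faces at their largest vertex *)

Section FaceSum.

Variable n : nat.
Notation T := (dart (complete_graph n)).
Notation L := (dart_swap (complete_graph n)).
Notation rots := (rotations (@tail n)).
Notation walk e0 := (walk L e0).

Implicit Type s : {perm T}.

Definition dominates s (e : T) := [forall d in porbit (L * s)%g e, tail d <= tail e].
Definition mult s (e : T) := #|[set d in porbit (L * s)%g e | tail d == tail e]|.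

Local Open Scope ring_scope.

(** Within one face the dominating darts are those at its largest vertex, each weighted by the
    inverse of their number. *)
Lemma faces_sum (R : numFieldType) s :
  #|porbits (L * s)%g|%:R = \sum_(e | dominates s e) (mult s e)%:R^-1 :> R.
Proof.
rewrite (partition_big (porbit (L * s)%g) (mem (porbits (L * s)%g))) /=; last first.
  by move=> e _; rewrite imset_f.
rewrite -sumr_const; apply: eq_bigr => _ /imsetP[x _ ->].
have [m mx max_m] : exists2 m, m \in porbit (L * s)%g x &
    forall d, d \in porbit (L * s)%g x -> (tail d <= tail m)%N.
  by case: (arg_maxnP (fun d : T => tail d) (porbit_id (L * s)%g x)) => m; exists m.
pose A := [set d in porbit (L * s)%g x | tail d == tail m].
have AE e : (dominates s e && (porbit (L * s)%g e == porbit (L * s)%g x)) = (e \in A).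
  rewrite !inE; apply/andP/andP => [[/forallP de /eqP eqp]|[ex /eqP tm]].
    have ex : e \in porbit (L * s)%g x by rewrite -eqp porbit_id.
    split=> //; rewrite -val_eqE eqn_leq max_m //=.
    by have /implyP := de m; rewrite eqp; apply.
  have eqp : porbit (L * s)%g e = porbit (L * s)%g x.
    by apply/eqP; rewrite eq_porbit_mem.
  split; last by rewrite eqp.
  by apply/forallP=> d; apply/implyP; rewrite eqp tm; exact: max_m.
rewrite (eq_bigl (fun e => e \in A)) => [|e]; last exact: AE.
rewrite (eq_bigr (fun=> #|A|%:R^-1)) => [|e eA]; last first.
  congr (_%:R^-1); rewrite /mult; congr #|pred_of_set _|.
  have := eA; rewrite -AE => /andP[_ /eqP ->].
  by move: eA; rewrite inE => /andP[_ /eqP ->].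
rewrite sumr_const -[_^-1 *+ _]mulr_natl divff // pnatr_eq0 -lt0n card_gt0.
by apply/finset.set0Pn; exists m; rewrite inE mx eqxx.
Qed.

(** The face traced from [e] stays at or below [tail e] and meets [e] again only after its full
    length; its darts at [tail e] other than [e] are the earlier returns. *)
Lemma dominates_closes_at s e : s \in rots -> dominates s e ->
  (head e < tail e)%N /\
  exists2 i, (i < #|T|)%N & closes_at e (mult s e).-1 i s.
Proof.
move=> rs /forall_inP de.
have walk_in t : walk e s t \in porbit (L * s)%g e by apply/porbitP; exists t; rewrite permX.
have le_head t : (head (walk e s t) <= tail e)%N.
  by rewrite -(tail_walkS _ _ rs) de.
split.
  rewrite ltn_neqAle (le_head 0%N) andbT.
  by rewrite val_eqE eq_sym; exact: tail_neq_head.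
have := card_porbit_neq0 (L * s)%g e; rewrite -lt0n => p_gt0.
exists #|porbit (L * s)%g e|.-1; first by rewrite prednK // max_card.
have wp : walk e s #|porbit (L * s)%g e|.-1.+1 = e.
  by rewrite prednK //; exact: iter_porbit.
rewrite /closes_at /returns_at /hits wp eqxx andbT -(tail_walkS _ _ rs) wp eqxx leqnn !andbT.
apply/andP; split.
  apply/aliveP=> t lt; split; first exact: le_head.
  have uq := uniq_traject_porbit (L * s)%g e.
  have := nth_uniq e (i := t.+1) (j := 0) _ _ uq.
  rewrite !size_traject -[X in (X < _)%N]add1n -ltn_subRL subn1 lt p_gt0 => /(_ erefl erefl).
  by rewrite !nth_traject // -1?[X in (X < _)%N]add1n -?ltn_subRL ?subn1 // => ->.
have -> : mult s e = count (fun d => tail d == tail e) (traject (L * s)%g e #|porbit (L * s)%g e|).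
  rewrite -size_filter -(card_uniqP _); last exact/filter_uniq/uniq_traject_porbit.
  by apply: eq_card => d; rewrite inE mem_filter porbit_traject andbC.
have -> : traject (L * s)%g e #|porbit (L * s)%g e| =
   [seq walk e s t | t <- iota 0 #|porbit (L * s)%g e|].
  apply: (@eq_from_nth _ e); rewrite size_traject ?size_map ?size_iota // => t lt.
  by rewrite nth_traject // (nth_map 0%N) ?size_iota // nth_iota.
(* The start [e] is split off; the dart at time [t + 1] lies at [tail e] exactly if the head at time
   [t] is [tail e]. *)
rewrite -{2}(prednK p_gt0) /= eqxx add1n /= /returns.
rewrite -(big_mkord xpredT (fun t => nat_of_bool (head (walk e s t) == tail e))).
rewrite /index_iota subn0 count_map -sum1_count /= -[iota 1 _]/(iota (1 + 0) _) iotaDl.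
rewrite big_map [X in _ == X]big_mkcond; apply/eqP/eq_bigr => t _.
by rewrite add1n (tail_walkS _ _ rs); case: eqP.
Qed.

End FaceSum.

(** * The contribution of each vertex *)

Section FaceBound.

Variable n : nat.
Notation T := (dart (complete_graph n)).
Notation L := (dart_swap (complete_graph n)).
Notation rots := (rotations (@tail n)).

Local Open Scope ring_scope.
Variable R : realFieldType.

(** With [r + 1 <= rho] darts at its largest vertex, a face closes with counter [r]; with more, the
    walk makes a return with counter [rho] and the weight is at most [1/(rho + 1)]. *)
Lemma sum_inv_mult (e : T) (rho : nat) : (head e < tail e)%N ->
  \sum_(s in rots | dominates s e) (mult s e)%:R^-1 <=
  \sum_(r < rho) (\sum_(i < #|T|) #|[set s in rots | closes_at e r i s]|)%:R / r.+1%:R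
  + (\sum_(i < #|T|) #|[set s in rots | returns_at e rho i s]|)%:R / rho.+1%:R :> R.
Proof.
move=> he.
pose F s : R := \sum_(r < rho) (\sum_(i < #|T|) closes_at e r i s)%:R / r.+1%:R
  + (\sum_(i < #|T|) returns_at e rho i s)%:R / rho.+1%:R.
suff le_F s : s \in rots -> dominates s e -> (mult s e)%:R^-1 <= F s.
  rewrite [leRHS](_ : _ = \sum_(s in rots) F s).
    rewrite big_mkcondr /=; apply: ler_sum => s rs.
    case: ifP => [de|_]; first exact: le_F.
    by rewrite addr_ge0 ?sumr_ge0 // => *; rewrite divr_ge0.
  have card_sum (Q : nat -> pred {perm T}) :
      (\sum_(i < #|T|) #|[set s in rots | Q i s]|)%N =
      (\sum_(s in rots) \sum_(i < #|T|) Q i s)%N.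
    by rewrite exchange_big; apply: eq_bigr => i _; rewrite card_set_sum.
  rewrite big_split /=; congr (_ + _); last by rewrite card_sum -mulr_suml -natr_sum.
  rewrite exchange_big; apply: eq_bigr => r _ /=.
  by rewrite card_sum -mulr_suml -natr_sum.
move=> rs de; have [_ [i lt_i ci]] := dominates_closes_at rs de.
have m_gt0 : (0 < mult s e)%N.
  by rewrite card_gt0; apply/finset.set0Pn; exists e; rewrite inE porbit_id eqxx.
have ge0 k : 0 <= (\sum_(i < #|T|) closes_at e k i s)%:R / k.+1%:R :> R.
  by rewrite divr_ge0.
have [lt|le] := ltnP (mult s e).-1 rho.
  apply: ler_wpDr; first by rewrite divr_ge0.
  rewrite (bigD1 (Ordinal lt)) //= prednK //; apply: ler_wpDr; first exact: sumr_ge0.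
  rewrite -[leLHS]mul1r ler_pM2r ?invr_gt0 ?ltr0n // ler1n.
  by rewrite (bigD1 (Ordinal lt_i)) //= ci.
apply: ler_wpDl; first exact: sumr_ge0.
have [j lt_j rj] : exists2 j, (j < #|T|)%N & returns_at e rho j s.
  move: le; rewrite leq_eqVlt => /predU1P[->|lt].
    by exists i => //; case/andP: ci.
  have /andP[/andP[hi _] _] := ci.
  have [j lt_ji rj] := hits_returns_at hi lt.
  by exists j => //; exact: ltn_trans lt_i.
apply: (@le_trans _ _ (1 / rho.+1%:R)).
  by rewrite div1r lef_pV2 ?posrE ?ltr0n // ler_nat -(prednK m_gt0) ltnS.
rewrite ler_pM2r ?invr_gt0 ?ltr0n // ler1n.
by rewrite (bigD1 (Ordinal lt_j)) //= rj.
Qed.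

(* Chosen such that n - 1 <= 9/5 (n - 2 (r + 1)) for r < cutoff, while
   n - 1 <= 9/2 (cutoff + 1). *)
Definition cutoff : nat := (4 * n.-1 + 9) %/ 18.

(** For [j = n - v], a bound on the expected number of faces with largest vertex [v]: the sum covers
    those with at most [cutoff] darts at [v], the last term the others. *)
Definition vertex_bound (j : nat) : R :=
  9 / 5 * (\sum_(r < cutoff) (r.+1%:R * j%:R ^+ r.+1)^-1)
  + 9 / 2 * (j%:R ^+ cutoff.+1)^-1.

Lemma sum_inv_mult_le (e : T) : (head e < tail e)%N ->
  n.-1%:R * \sum_(s in rots | dominates s e) (mult s e)%:R^-1 <=
  #|rots|%:R * vertex_bound (n - tail e).
Proof.
move=> he; set j := (n - tail e)%N; set d : R := n.-1%:R.
have lt_v : (tail e < n)%N := ltn_ord _.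
have j_gt0 : 0 < j%:R :> R by rewrite ltr0n subn_gt0.
have d_ge0 : 0 <= d by [].
apply: (le_trans (ler_wpM2l d_ge0 (sum_inv_mult cutoff he))).
have D_le r : (\sum_(i < #|T|) #|[set s in rots | returns_at e r i s]|)%:R <=
    #|rots|%:R * (j%:R ^+ r.+1)^-1 :> R.
  rewrite ler_pdivlMr ?exprn_gt0 // mulrC -natrX -natrM ler_nat.
  exact: card_returns_at.
have C_le r : (r < cutoff)%N ->
    d * (\sum_(i < #|T|) #|[set s in rots | closes_at e r i s]|)%:R <=
    9 / 5 * (#|rots|%:R * (j%:R ^+ r.+1)^-1).
  move=> lt_r; apply: le_trans (ler_wpM2l _ (D_le r)); last by rewrite divr_ge0.
  have key : (5 * (n.-1 * \sum_(i < #|T|) #|[set s in rots | closes_at e r i s]|)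
     <= 9 * \sum_(i < #|T|) #|[set s in rots | returns_at e r i s]|)%N.
    rewrite !big_distrr /=; apply: leq_sum => i _.
    apply: leq_trans (_ : 9 * ((n.-1 - 2 * r.+1).+1 *
      #|[set s in rots | closes_at e r i s]|) <= _)%N; last first.
      by rewrite leq_mul2l card_closes_at.
    rewrite !mulnA leq_mul2r; apply/orP; right.
    move: lt_r; rewrite /cutoff; lia.
  move: key; rewrite -(ler_nat R) !natrM -/d => key.
  by rewrite mulrAC ler_pdivlMr // mulrC.
rewrite /vertex_bound [leRHS]mulrDr [leLHS]mulrDr; apply: lerD.
  rewrite !mulr_sumr; apply: ler_sum => r _; rewrite mulrA invfM.
  rewrite [leRHS](_ : _ = 9 / 5 * (#|rots|%:R * (j%:R ^+ r.+1)^-1) / r.+1%:R).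
    by rewrite ler_pM2r ?invr_gt0 ?ltr0n ?C_le.
  by rewrite mulrCA -!mulrA; congr (_ * (_ * _)); rewrite mulrCA mulrC mulrA.
have rho_d : d / cutoff.+1%:R <= 9 / 2.
  rewrite ler_pdivrMr ?ltr0n // mulrAC ler_pdivlMr // -!natrM ler_nat /cutoff; lia.
rewrite mulrCA [leRHS]mulrCA [leRHS]mulrC.
by apply: ler_pM; rewrite ?D_le ?divr_ge0.
Qed.

(** The [n - 1] darts at each vertex cancel the factor in the bound per dart; a dart with head above
    its tail dominates no face. *)
Lemma sum_faces_le : (1 < n)%N ->
  \sum_(s in rots) #|porbits (L * s)%g|%:R <=
  #|rots|%:R * \sum_(v < n) vertex_bound (n - v).
Proof.
move=> n_gt1; have d_gt0 : 0 < n.-1%:R :> R by rewrite ltr0n; lia.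
have vb_ge0 j : 0 <= vertex_bound j.
  by rewrite addr_ge0 ?mulr_ge0 ?divr_ge0 ?invr_ge0 ?exprn_ge0 ?sumr_ge0.
rewrite (eq_bigr _ (fun s _ => faces_sum R s)).
rewrite (exchange_big_dep xpredT) //=.
rewrite -(ler_pM2l d_gt0) mulr_sumr.
apply: (@le_trans _ _ (\sum_(e : T) #|rots|%:R * vertex_bound (n - tail e))).
  apply: ler_sum => e _.
  have [he|he] := ltnP (head e) (tail e); first exact: sum_inv_mult_le.
  rewrite big_pred0 ?mulr0 ?mulr_ge0 // => s; apply/negP=> /andP[rs de].
  by have [] := dominates_closes_at rs de; rewrite ltnNge he.
rewrite (partition_big (@tail n) xpredT) //= mulrCA !mulr_sumr ler_sum // => v _.
rewrite (eq_bigr (fun=> #|rots|%:R * vertex_bound (n - v))) => [|e /eqP -> //].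
by have := card_tail v; rewrite sumr_const cardsE => ->; rewrite -[leLHS]mulr_natl mulrCA lexx.
Qed.

End FaceBound.

(** * Rotation systems as permutations of the darts *)

Section RotationSystems.

Variable G : sgraph.
Notation tl := (fun d : dart G => (val d).1).

Lemma rotation_perm_on (r : rotation_system G) v : perm_on (darts_at v) (val r v).
Proof. by have /forallP/(_ v)/andP[] := valP r. Qed.

(** Each factor moves only the darts at its own vertex and keeps them there. *)
Lemma rotation_productE (r : rotation_system G) d :
  rotation_product r d = val r (val d).1 d.
Proof.
rewrite /rotation_product.
have prodE (s : seq G) : uniq s ->
    (\prod_(v <- s) val r v)%g d = if (val d).1 \in s then val r (val d).1 d else d.
  elim: s d => [|v s IH] d /=; first by rewrite big_nil perm1.
  move=> /andP[vs us]; rewrite big_cons permM IH // in_cons.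
  have [dv|dv] := eqVneq (val d).1 v.
    have : val r v d \in darts_at v.
      by rewrite (perm_closed _ (rotation_perm_on r v)) inE dv.
    by rewrite inE => /eqP ->; rewrite (negbTE vs) /= dv.
  by rewrite (out_perm (rotation_perm_on r v)) // inE.
by rewrite prodE ?index_enum_uniq // mem_index_enum.
Qed.

Lemma rotation_product_in (r : rotation_system G) :
  rotation_product r \in rotations tl.
Proof.
apply/rotationsP=> d d'.
have /forallP/(_ (val d).1)/andP[on /forall_inP/(_ d)] := valP r.
rewrite inE eqxx => /(_ isT)/eqP pd.
suff -> : porbit (rotation_product r) d = porbit (val r (val d).1) d by rewrite pd inE.
apply/porbit_setP => x.
suff iterE i : iter i (rotation_product r) d = iter i (val r (val d).1) d.
  by apply/porbitP/porbitP=> -[i ->]; exists i; rewrite !permX iterE.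
elim: i => //= i ->; rewrite rotation_productE.
have : iter i (val r (val d).1) d \in darts_at (val d).1.
  by rewrite -pd -permX mem_porbit.
by rewrite inE => /eqP ->.
Qed.

Lemma rotation_product_inj : injective (@rotation_product G).
Proof.
move=> r r' eq_r; apply/val_inj/ffunP=> v; apply/permP=> d.
have [dv|dv] := boolP (d \in darts_at v); last first.
  by rewrite !(out_perm (rotation_perm_on _ v)).
by move: dv; rewrite inE => /eqP <-; rewrite -!rotation_productE eq_r.
Qed.

Lemma rotation_product_onto s : s \in rotations tl ->
  exists r : rotation_system G, rotation_product r = s.
Proof.
move=> rs.
have rE v : {in darts_at v, restr_perm (darts_at v) s =1 s}.
  move=> d dv; apply: restr_permE => //; apply/astabsP=> {dv}d /=.
  by rewrite !inE /= /aperm (rotations_h d rs).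
pose f := [ffun v => restr_perm (darts_at v) s].
have fP : [forall v, single_cycle_on (darts_at v) (f v)].
  apply/forallP=> v; rewrite /single_cycle_on ffunE restr_perm_on /=.
  apply/forall_inP=> d dv; apply/eqP/setP=> d'.
  have -> : (d' \in darts_at v) = (d' \in porbit s d).
    by move: dv; rewrite (rotationsP _ _ rs) !inE => /eqP ->.
  suff iterE i : iter i (restr_perm (darts_at v) s) d = iter i s d.
    by apply/porbitP/porbitP=> -[i ->]; exists i; rewrite !permX iterE.
  elim: i => //= i ->; rewrite rE //.
  by move: dv; rewrite !inE => /eqP <-; rewrite -(rotationsP _ _ rs) -permX mem_porbit.
exists (Sub f fP); apply/permP=> d; rewrite rotation_productE /= ffunE rE //.
by rewrite inE.
Qed.

Local Open Scope ring_scope.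

(** The product map is a bijection onto [rotations tl], so averages can be taken over permutations
    of the darts. *)
Lemma sum_rotation_product (R : nmodType) (F : {perm dart G} -> R) :
  \sum_(r : rotation_system G) F (rotation_product r) = \sum_(s in rotations tl) F s.
Proof.
rewrite -(big_imset F (in2W rotation_product_inj)) /=; apply: eq_bigl => s.
apply/imsetP/idP=> [[r _ ->]|/rotation_product_onto[r <-]].
  exact: rotation_product_in.
by exists r.
Qed.

Lemma card_rotation_system : #|rotation_system G| = #|rotations tl|.
Proof. by have := sum_rotation_product (fun=> 1%N); rewrite !sum1_card. Qed.

End RotationSystems.

(** * Estimates *)

Local Open Scope ring_scope.

Section Estimates.

Variable R : realType.

Lemma ln_ge_1BV (x : R) : 0 < x -> 1 - x^-1 <= ln x.
Proof.
move=> x_gt0; have := expR_ge1Dx (- ln x).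
by rewrite expRN lnK ?posrE //; lra.
Qed.

(** The increments compare: [1/(m+2) <= ln((m+2)/(m+1))]. *)
Lemma harmonic_le_ln m : \sum_(k < m) (k.+2%:R)^-1 <= ln (m.+1%:R : R).
Proof.
elim: m => [|m IH]; first by rewrite big_ord0 ln1.
rewrite big_ord_recr /=.
have -> : m.+2%:R = m.+1%:R * (m.+2%:R / m.+1%:R) :> R.
  by rewrite mulrCA divff ?mulr1 // pnatr_eq0.
rewrite lnM ?posrE ?divr_gt0 ?ltr0n //; apply: lerD => //.
apply: le_trans (ln_ge_1BV _); last by rewrite divr_gt0 ?ltr0n.
rewrite invf_div mulrCA divff ?mulr1 ?pnatr_eq0 // -[X in X - _](@divff _ m.+2%:R) ?pnatr_eq0 //.
by rewrite -mulrBl -natrB // subSnn div1r.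
Qed.

(** From the second term on [1/(r+1) <= 1/2], and the geometric series from [x^-2] on is
    [1/(x-1) - 1/x], which telescopes over integers [x]. *)
Lemma sum_inv_mul_exp_le c (x : R) : 1 < x ->
  \sum_(r < c) (r.+1%:R * x ^+ r.+1)^-1 <= x^-1 + ((x - 1)^-1 - x^-1) / 2.
Proof.
move=> x_gt1; have x0 : 0 < x by lra.
have x1 : 0 < x - 1 by lra.
have dE : (x - 1)^-1 - x^-1 = (x - 1)^-1 * x^-1 by field; rewrite !gt_eqF.
case: c => [|c].
  by rewrite big_ord0 dE addr_ge0 ?divr_ge0 ?mulr_ge0 ?invr_ge0 ?ltW.
(* Half of the remaining geometric tail is subtracted for the induction. *)
suff : \sum_(r < c.+1) (r.+1%:R * x ^+ r.+1)^-1 <=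
    x^-1 + ((x - 1)^-1 * x^-1) / 2 - (x - 1)^-1 * (x ^+ c.+1)^-1 / 2.
  move/le_trans; apply; rewrite dE gerBl ?divr_ge0 ?mulr_ge0 ?invr_ge0 ?exprn_ge0 ?ltW //.
elim: c => [|c IH]; first by rewrite big_ord1 expr1 mul1r addrK.
rewrite big_ord_recr [x ^+ c.+2]exprS /=; move: IH.
have : 0 < x ^+ c.+1 by exact: exprn_gt0.
move: (x ^+ c.+1) => y y0 IH.
apply: (le_trans (lerD IH (_ : _ <= (2 * (x * y))^-1))).
  by rewrite lef_pV2 ?posrE ?mulr_gt0 // ler_pM2r ?mulr_gt0 // ler_nat.
rewrite le_eqVlt; apply/orP; left; apply/eqP; field.
by rewrite !gt_eqF.
Qed.

(** By [1/k^2 <= 1/(k-1) - 1/k] for [k >= 3], the sum is at most [1/4 + 1/2]. *)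
Lemma sum_inv_square_le m : \sum_(k < m) (k.+2%:R ^+ 2)^-1 <= 3 / 4 :> R.
Proof.
case: m => [|m]; first by rewrite big_ord0; lra.
suff : \sum_(k < m.+1) (k.+2%:R ^+ 2)^-1 <= 3 / 4 - (m.+2%:R)^-1 :> R.
  by move/le_trans; apply; rewrite gerBl invr_ge0.
elim: m => [|m IH]; first by rewrite big_ord1 expr2 invfM /=; lra.
rewrite big_ord_recr /=; set x : R := m.+2%:R in IH *.
have -> : m.+3%:R = x + 1 by rewrite /x [in RHS]natr1.
have x0 : 0 < x by rewrite /x ltr0n.
suff : ((x + 1) ^+ 2)^-1 <= x^-1 - (x + 1)^-1.
  by move=> h; rewrite (le_trans (lerD IH h)) // addrA subrK.
have -> : x^-1 - (x + 1)^-1 = (x * (x + 1))^-1.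
  by field; rewrite !gt_eqF // addr_gt0.
rewrite lef_pV2 ?posrE ?mulr_gt0 ?exprn_gt0 ?addr_gt0 // expr2 ler_pM2r ?addr_gt0 //.
by rewrite lerDl.
Qed.

(** Two harmonic sums arise, over [r] for [j = 1] and over [j >= 2] for [r = 0], each giving
    [9/5 ln n]. The constant is [9/5 + 9/2 + 9/10 + 27/8]. *)
Lemma sum_vertex_bound_le n : (4 <= n)%N ->
  \sum_(v < n) vertex_bound n R (n - v) <= 18 / 5 * ln n%:R + 423 / 40.
Proof.
case: n => // m n_ge4; set c := cutoff m.+1.
(* So the exponent [cutoff + 1] is at least 2, and inverse squares bound the last terms for
   [j >= 2]. *)
have c_gt0 : (0 < c)%N by rewrite /c /cutoff; lia.
have c_le : (c <= m.+1)%N by rewrite /c /cutoff; lia.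
rewrite (reindex_inj rev_ord_inj) /=.
under eq_bigr => v _ do rewrite subKn //.
rewrite big_ord_recl /=.
have vb1 : vertex_bound m.+1 R 1 <= 9 / 5 * (1 + ln m.+1%:R) + 9 / 2.
  rewrite /vertex_bound expr1n invr1 mulr1 lerD2r ler_pM2l; last by lra.
  apply: (@le_trans _ _ (\sum_(r < m.+1) (r.+1%:R)^-1)).
    rewrite (big_ord_widen _ (fun r => (r.+1%:R * 1 ^+ r.+1)^-1 : R) c_le) big_mkcond /=.
    by apply: ler_sum => r _; rewrite expr1n mulr1; case: ifP => // _; rewrite invr_ge0.
  by rewrite big_ord_recl /= invr1 lerD2l harmonic_le_ln.
have vb2 (k : 'I_m) : true -> vertex_bound m.+1 R (bump 0 k).+1 <=
    9 / 5 * (k.+2%:R^-1 + (k.+1%:R^-1 - k.+2%:R^-1) / 2) + 9 / 2 * (k.+2%:R ^+ 2)^-1.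
  move=> _; rewrite /vertex_bound /bump /= add1n; apply: lerD.
    rewrite ler_pM2l; last by lra.
    have -> : k.+1%:R = k.+2%:R - 1 :> R by rewrite -[k.+2]addn1 natrD addrK.
    by apply: sum_inv_mul_exp_le; rewrite ltr1n.
  rewrite ler_pM2l; last by lra.
  rewrite lef_pV2 ?posrE ?exprn_gt0 ?ltr0n // ler_weXn2l // ler1n //.
apply: (le_trans (lerD vb1 (ler_sum _ vb2))).
rewrite big_split /= -!mulr_sumr big_split /= -mulr_suml.
have -> : \sum_(k < m) (k.+1%:R^-1 - k.+2%:R^-1) = 1 - m.+1%:R^-1 :> R.
  elim: (m) => [|k IH]; first by rewrite big_ord0 invr1 subrr.
  by rewrite big_ord_recr IH /= addrA subrK.
have := harmonic_le_ln m; have := sum_inv_square_le m.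
have : 0 <= m.+1%:R^-1 :> R by rewrite invr_ge0.
move: (ln _) (\sum_(k < m) _) (\sum_(k < m) _) (m.+1%:R^-1) => x y z w; lra.
Qed.

End Estimates.

(** * From counting to the expected number of faces *)

Lemma uniform_expectation_le (R : realType) (T : finType) (X : T -> R) (c : R) :
  0 <= c -> \sum_(t : T) X t <= #|T|%:R * c -> uniform_expectation X <= c.
Proof.
move=> c0 leX; rewrite /uniform_expectation -mulr_sumr.
(* For empty [T] the weight is [0^-1 = 0]. *)
have [T0|T_gt0] := posnP #|T|; first by rewrite T0 invr0 mul0r.
by rewrite ler_pdivrMl ?ltr0n.
Qed.

Lemma card_complete_dart n : #|dart (complete_graph n)| = (n * n.-1)%N.
Proof.
rewrite -sum1_card (partition_big (@tail n) xpredT) //=.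
transitivity (\sum_(v < n) n.-1)%N; last by rewrite sum_nat_const card_ord.
by apply: eq_bigr => v _; rewrite sum1_card -(card_tail v) cardsE; apply: eq_card.
Qed.

(** Every face contains a dart, except the face of the one-vertex graph. This settles [n <= 4]. *)
Lemma expected_num_faces_le_darts (R : realType) (n : nat) :
  expected_num_faces R (complete_graph n) <= (maxn 1 (n * n.-1))%:R.
Proof.
apply: uniform_expectation_le => //.
rewrite mulr_natl -sumr_const; apply: ler_sum => r _; rewrite ler_nat /num_faces.
case: ifP => _; first exact: leq_maxl.
by rewrite -card_complete_dart; apply: leq_trans (leq_imset_card _ _) (leq_maxr _ _).
Qed.

Lemma expected_num_faces_le_ln (R : realType) (n : nat) : (4 <= n)%N ->
  expected_num_faces R (complete_graph n) <= 18 / 5 * ln (n%:R : R) + 423 / 40.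
Proof.
move=> n_ge4; apply: uniform_expectation_le.
  have := @ln_ge0 R n%:R; rewrite ler1n; move/(_ (ltnW (ltnW (ltnW n_ge4)))); lra.
rewrite (eq_bigr (fun r => #|porbits (dart_swap _ * rotation_product r)%g|%:R)); last first.
  by move=> r _; rewrite /num_faces card_ord gtn_eqF ?(ltnW (ltnW n_ge4)).
rewrite (sum_rotation_product (fun s => #|porbits (dart_swap (complete_graph n) * s)%g|%:R)).
rewrite card_rotation_system.
apply: (le_trans (@sum_faces_le n R _)); first exact: ltnW (ltnW n_ge4).
by rewrite ler_wpM2l ?sum_vertex_bound_le.
Qed.

(** For [n >= 5] the first bound needs [32/5 ln n >= 343/40], about [ln n >= 1.3399]. Splitting 5
    into factors near 1 makes [1 - 1/x] precise enough: it gives [41/30]. *)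
Lemma ln5_gt (R : realType) : 134 / 100 < ln (5 : R).
Proof.
have -> : 5 = 5 / 4 * (4 / 3) * (4 / 3) * (3 / 2) * (3 / 2) :> R by field.
have [a0 b0 c0] : [/\ 0 < 5 / 4 :> R, 0 < 4 / 3 :> R & 0 < 3 / 2 :> R] by split; lra.
do 4![rewrite lnM ?posrE; try by rewrite ?mulr_gt0].
have h1 : 1 - (5 / 4)^-1 <= ln (5 / 4 : R) by exact: ln_ge_1BV.
have h2 : 1 - (4 / 3)^-1 <= ln (4 / 3 : R) by exact: ln_ge_1BV.
have h3 : 1 - (3 / 2)^-1 <= ln (3 / 2 : R) by exact: ln_ge_1BV.
move: h1 h2 h3; rewrite !invf_div; lra.
Qed.

Theorem theorem1p5 (R : realType) (n : nat) (n_ge1 : (1 <= n)%N) :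
  expected_num_faces R (complete_graph n) <= 10 * ln (n%:R : R) + 2
  /\ (expR (expR 16) <= (n%:R : R) ->
      expected_num_faces R (complete_graph n) <= 365 / 100 * ln (n%:R : R)).
Proof.
split.
  have [n_ge5|n_le4] := leqP 5 n.
    apply: (le_trans (expected_num_faces_le_ln R _)); first exact: ltnW.
    have : ln 5 <= ln (n%:R : R) by rewrite ler_ln ?posrE ?ltr0n // ler_nat.
    have := ln5_gt R; lra.
  apply: (le_trans (expected_num_faces_le_darts _ _)).
  have := @ln_ge_1BV R n%:R; rewrite ltr0n => /(_ n_ge1).
  case: n n_ge1 n_le4 => [|[|[|[|[|n]]]]] //= _ _.
  - by rewrite ln1 (_ : maxn _ _ = 1%N) //; lra.
  - by rewrite (_ : maxn _ _ = 2%N) //; lra.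
  - by rewrite (_ : maxn _ _ = 6%N) //; lra.
  (* The bound [1 - 1/x] at 4 gives only [3/4]; used twice at 2 it gives [ln 4 >= 1], just enough
     for 12. *)
  rewrite (_ : maxn _ _ = 12%N) //; have -> : 4 = 2 * 2 :> R by rewrite -natrM.
  have := @ln_ge_1BV R 2; rewrite lnM ?posrE ?ltr0n // => /(_ isT); lra.
move=> n_big.
(* The slack [(365/100 - 18/5) ln n] absorbs [423/40] once [ln n >= 211.5]; here
   [ln n >= e^16 >= 5^4]. *)
have e16 : 625 <= expR 16 :> R.
  have -> : 16 = 4%:R * 4 :> R by rewrite -natrM.
  rewrite expRM_natl (_ : 625 = 5 ^+ 4); last by rewrite -natrX.
  by rewrite lerXn2r ?nnegrE ?expR_ge0 //; have := expR_ge1Dx (4 : R); lra.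
have n_ge4 : (4 <= n)%N.
  by rewrite -(ler_nat R); have := expR_ge1Dx (expR 16 : R); lra.
apply: (le_trans (expected_num_faces_le_ln R n_ge4)).
have : expR 16 <= ln (n%:R : R).
  by rewrite -[leLHS]expRK ler_ln ?posrE ?expR_gt0 // ltr0n.
lra.
Qed.
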